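(* Let $C$ be a linear code of length $n$ and dimension $k$ over $\mathbb{F}_q$, with normalized weight enumerator $A_n(x,y)$ and normalized rank-generating polynomial $W_n(x,y)$ (defined in the context). Then there is a polynomial $\tilde W_n(x,y)$ with rational coefficients such that $$A_n(s,t)(s+t)^{n+1} = W_n\!\left(\frac{qt}{s+t},\frac{s+t}{t}\right)(s+t)^k t^{n-k} s^{n+1} + \tilde W_n\!\left(\frac{qs}{s+t},\frac{s+t}{s}\right)(s+t)^k s^{n-k} t^{n+1},$$ as an identity of polynomials in $s,t$, in which both terms on the right-hand side are polynomials in $s,t$. Equivalently, setting $s=1$, $$A_n(1,t)(1+t)^{n+1} \equiv W_n\!\left(\frac{qt}{1+t},\frac{1+t}{t}\right)(1+t)^k t^{n-k} \pmod{t^{n+1}}.$$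
   Context: $\mathbb{F}_q$ is the finite field with $q$ elements, and a linear code of length $n$ and dimension $k$ is a $k$-dimensional linear subspace $C\subseteq \mathbb{F}_q^n$. Let $A_i$ be the number of codewords with exactly $i$ nonzero coordinates. Let $G$ be the family of the $n$ columns (indexed by $\{1,\ldots,n\}$, so equal columns at different positions count separately) of a $k\times n$ generator matrix of $C$ (a matrix whose rows form a basis of $C$). For a subfamily $A\subseteq G$ let $|A|$ be its number of columns and $r(A)$ the rank of $A$, i.e. the dimension of its linear span; thus $r(G)=k$. Define $$A_n(x,y) = \sum_{i=0}^n \frac{1}{\binom{n}{i}} A_i x^{n-i}y^i, \qquad W_n(x,y) = \sum_{i=0}^n \frac{1}{\binom{n}{i}} \sum_{A\subseteq G,\ |A|=i} x^{r(G)-r(A)}y^{|A|-r(A)}.$$ *)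

(* Defs.v *)
(* MathComp, with multinomials for bivariate polynomials. *)
From HB Require Import structures.
From mathcomp Require Import all_boot all_order all_algebra.
From mathcomp Require Import mpoly.

Set Implicit Arguments.
Unset Strict Implicit.
Unset Printing Implicit Defensive.

Import GRing.Theory.
Local Open Scope ring_scope.

Notation "x %:F" := (tofrac x) : ring_scope.

(* A linear code over F of length n is a subspace C : {vspace 'rV[F]_n}. *)

Definition hweight (F : finFieldType) (n : nat) (v : 'rV[F]_n) : nat :=
  #|[set j : 'I_n | v 0 j != 0]|.

Definition weight_count (F : finFieldType) (n : nat) (C : {vspace 'rV[F]_n})
    (i : nat) : nat :=
  #|[set v : 'rV[F]_n | (v \in C) && (hweight v == i)]|.

Definition generator_matrix (F : finFieldType) (n k : nat)
    (C : {vspace 'rV[F]_n}) (G : 'M[F]_(k, n)) : bool :=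
  basis_of C [seq row i G | i <- enum 'I_k].

(* A subfamily of the columns of G is given by its set of positions, so equal
   columns at different positions are counted separately. *)
Definition col_rank (F : finFieldType) (n k : nat) (G : 'M[F]_(k, n))
    (A : {set 'I_n}) : nat :=
  \dim <<[seq col j G | j <- enum A]>>%VS.

Definition bivar_x : {mpoly rat[2]} := 'X_ord0.
Definition bivar_y : {mpoly rat[2]} := 'X_ord_max.

Definition norm_weight_enum (F : finFieldType) (n : nat)
    (C : {vspace 'rV[F]_n}) : {mpoly rat[2]} :=
  \sum_(i < n.+1)
    (('C(n, i)%:R)^-1 * (weight_count C i)%:R : rat) *:
      (bivar_x ^+ (n - i) * bivar_y ^+ i).

(* The subtractions of natural numbers are exact:
   col_rank G A <= col_rank G setT and col_rank G A <= #|A|. *)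
Definition norm_rank_gen (F : finFieldType) (n k : nat) (G : 'M[F]_(k, n)) :
    {mpoly rat[2]} :=
  \sum_(i < n.+1)
    (('C(n, i)%:R)^-1 : rat) *:
      \sum_(A : {set 'I_n} | #|A| == i)
        (bivar_x ^+ (col_rank G [set: 'I_n] - col_rank G A)
         * bivar_y ^+ (#|A| - col_rank G A)).

(* p(x, y) in a field K. The coefficients are embedded by ratr, which is the
   inclusion of the rationals when K has characteristic 0; K is only ever a
   field of rational functions over rat below. *)
Definition eval2 (K : fieldType) (p : {mpoly rat[2]}) (x y : K) : K :=
  mmap (@ratr K) (fun i : 'I_2 => if i == ord0 then x else y) p.

Definition is_polynomial (R : idomainType) (f : {fraction R}) : Prop :=
  exists p : R, f = p%:F.

Definition poly_congr (m : nat) (f g : {fraction {poly rat}}) : Prop :=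
  exists p q : {poly rat}, [/\ f = p%:F, g = q%:F & 'X^m %| p - q].

(* Main.v *)
Require Import Defs.
From HB Require Import structures.
From mathcomp Require Import all_boot all_order all_algebra all_field.
From mathcomp Require Import ring zify.
From mathcomp Require Import mpoly.

Set Implicit Arguments.
Unset Strict Implicit.
Unset Printing Implicit Defensive.

Import GRing.Theory.
Local Open Scope ring_scope.

(* Put a_w = A_w / C(n, w), z = s + t and
   N_w(x, z) = sum_(b <= n) C(b, w) x^b z^(n - b).  Counting the pairs of a
   codeword and a set of positions on which it vanishes shows that the W_n-term
   divided by s^(n+1) is sum_w a_w N_w(t, z).  The negative binomial identity
   s^(n-w) t^w z^(n+1) = s^(n+1) N_w(t, z) + t^(n+1) N_(n-w)(s, z) then leaves
   t^(n+1) sum_w a_w N_(n-w)(s, z).  Any combination of the forms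
   s^b z^(n-b) arises from a polynomial evaluated at X = q s / z, Y = z / s,
   because X Y = q makes every integer power of Y available; so the
   complementary polynomial can be written down without using duality. *)

(** * Truncated negative binomial sums and the splitting identity *)

Section NegativeBinomial.
Variable R : comNzRingType.
Implicit Types x z : R.

(** At z = 1 this is the truncation after degree n of the power series x^w / (1 - x)^(w+1); z makes
    it homogeneous of degree n. *)
Definition negbin_sum n w x z : R :=
  \sum_(b < n.+1) 'C(b, w)%:R * x ^+ b * z ^+ (n - b).

Lemma negbin_sumS_top n w x z :
  negbin_sum n.+1 w x z = z * negbin_sum n w x z + 'C(n.+1, w)%:R * x ^+ n.+1.
Proof.
rewrite /negbin_sum big_ord_recr /= subnn expr0 mulr1; congr (_ + _).
rewrite mulr_sumr; apply: eq_bigr => b _.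
have leb : (b <= n)%N by rewrite -ltnS.
by rewrite (subSn leb) exprS; ring.
Qed.

Lemma negbin_sumSS n w x z :
  negbin_sum n.+1 w.+1 x z = x * (negbin_sum n w x z + negbin_sum n w.+1 x z).
Proof.
rewrite /negbin_sum big_ord_recl bin0n /= !mul0r add0r -big_split mulr_sumr.
apply: eq_bigr => b _; rewrite /= /bump /= add1n subSS binS natrD exprS; ring.
Qed.

(** With z = s + t, the sum at [n.+1], [w.+1] is expanded once by its top term and once by Pascal's
    rule; comparing the two leaves the factor z - t = s. *)
Lemma negbin_sum_step n w s t :
  s * negbin_sum n w.+1 t (s + t) =
  t * negbin_sum n w t (s + t) - 'C(n.+1, w.+1)%:R * t ^+ n.+1.
Proof.
have := negbin_sumS_top n w.+1 t (s + t).
rewrite negbin_sumSS => eq_sums.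
apply/eqP; rewrite -subr_eq0; apply/eqP.
transitivity ((s + t) * negbin_sum n w.+1 t (s + t)
   + 'C(n.+1, w.+1)%:R * t ^+ n.+1
   - t * (negbin_sum n w t (s + t) + negbin_sum n w.+1 t (s + t))).
  by ring.
by rewrite eq_sums subrr.
Qed.

End NegativeBinomial.

Lemma rmorph_negbin_sum (R S : comNzRingType) (f : {rmorphism R -> S})
    n w (x z : R) :
  f (negbin_sum n w x z) = negbin_sum n w (f x) (f z).
Proof.
rewrite /negbin_sum rmorph_sum; apply: eq_bigr => b _.
by rewrite !rmorphM !rmorphXn /= rmorph_nat.
Qed.

(* For s + t = 1, dividing by s ^ (n - w) * t ^ w gives the negative binomial
   identity: in independent trials with outcomes s and t, either w + 1 outcomes
   s come before n - w + 1 outcomes t, or conversely. *)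
Lemma negbin_split (R : idomainType) (n w : nat) (s t : R) :
  s != 0 -> (w <= n)%N ->
  s ^+ (n - w) * t ^+ w * (s + t) ^+ n.+1 =
  s ^+ n.+1 * negbin_sum n w t (s + t)
  + t ^+ n.+1 * negbin_sum n (n - w) s (s + t).
Proof.
move=> s0; elim: w => [_|w IHw ltwn].
  have -> : negbin_sum n (n - 0) s (s + t) = s ^+ n.
    rewrite /negbin_sum subn0 big_ord_recr /= big1 => [|b _].
      by rewrite binn subnn expr0; ring.
    by rewrite bin_small ?mul0r.
  have -> : (s + t) ^+ n.+1 = s * negbin_sum n 0 t (s + t) + t ^+ n.+1.
    apply/eqP; rewrite -subr_eq; apply/eqP; rewrite subrXX addrK.
    congr (_ * _); apply: eq_bigr => b _.
    by rewrite bin0 mul1r mulrC.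
  by rewrite subn0 expr0 (exprS s); ring.
apply: (mulfI s0); have {IHw} := IHw (ltnW ltwn).
have -> : (n - w = (n - w.+1).+1)%N by rewrite -subSn.
set j := (n - w.+1)%N => IHw.
have step2 := negbin_sum_step n j t s.
(* The recurrence is used for both sums, with [s] and [t] exchanged in the second; by this symmetry
   their boundary terms cancel. *)
have binE : 'C(n.+1, j.+1) = 'C(n.+1, w.+1).
  by rewrite -bin_sub; [congr 'C(_, _); rewrite /j | ]; lia.
rewrite (addrC t s) binE in step2.
rewrite mulrDr [s * (s ^+ _ * _)]mulrCA negbin_sum_step.
transitivity (t * (s ^+ j.+1 * t ^+ w * (s + t) ^+ n.+1)).
  by rewrite (exprS s) (exprS t); ring.
rewrite IHw; apply/eqP; rewrite -subr_eq0; apply/eqP.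
transitivity (t ^+ n.+1 * (t * negbin_sum n j.+1 s (s + t)
   - (s * negbin_sum n j s (s + t) - 'C(n.+1, w.+1)%:R * s ^+ n.+1))).
  by ring.
by rewrite step2 subrr mulr0.
Qed.

(** Both sides count disjoint pairs of a w-set and an a-set in n points: the trinomial coefficient
    n! / (a! w! (n-a-w)!), or 0 if a + w > n. *)
Lemma mul_bin_swap (n w a : nat) : (w <= n)%N -> (a <= n)%N ->
  ('C(n - w, a) * 'C(n, w) = 'C(n - a, w) * 'C(n, a))%N.
Proof.
move=> lewn lean; have [leawn|ltwna] := leqP (a + w) n; last first.
  have -> : 'C(n - w, a) = 0%N by apply: bin_small; lia.
  by have -> : 'C(n - a, w) = 0%N by apply: bin_small; lia.
have e1 := bin_fact lewn; have e2 := bin_fact lean.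
have le1 : (a <= n - w)%N by lia.
have le2 : (w <= n - a)%N by lia.
have e3 := bin_fact le1; have e4 := bin_fact le2.
have e5 : (n - w - a = n - a - w)%N by lia.
rewrite e5 in e3.
have posf : (0 < a`! * w`! * (n - a - w)`!)%N by rewrite !muln_gt0 !fact_gt0.
apply/eqP; rewrite -(eqn_pmul2r posf); apply/eqP.
transitivity n`!.
  by rewrite -e1 -e3; ring.
by rewrite -e2 -e4; ring.
Qed.

Lemma card_sets_avoiding (T : finType) (D : {set T}) (a : nat) :
  #|[set A : {set T} | [forall j in A, j \notin D] && (#|A| == a)]|
  = 'C(#|T| - #|D|, a).
Proof.
have -> : (#|T| - #|D|)%N = #|~: D| by rewrite [RHS]cardsCs setCK.
rewrite -cards_draws.
apply: eq_card => A; rewrite !inE; congr (_ && _).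
apply/forall_inP/subsetP => sub j /sub; by rewrite inE.
Qed.

(** * Column ranks and codewords vanishing on a set of positions *)

Section Code.
Variables (F : finFieldType) (n k : nat) (G : 'M[F]_(k, n)).

Lemma col_rank_le_card (A : {set 'I_n}) : (col_rank G A <= #|A|)%N.
Proof. by rewrite (leq_trans (dim_span _)) // size_map -cardE. Qed.

Lemma col_rank_le_height (A : {set 'I_n}) : (col_rank G A <= k)%N.
Proof.
rewrite (leq_trans (dimvS (subvf _))) // dimvf /dim /=.
by rewrite muln1.
Qed.

Lemma vanish_span (u : 'rV[F]_k) (X : seq 'cV[F]_k) :
  (forall x, x \in X -> u *m x = 0) ->
  forall x, x \in <<X>>%VS -> u *m x = 0.
Proof.
move=> uX0 x; rewrite -[X]in_tupleE => /coord_span ->.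
rewrite mulmx_sumr big1 // => i _.
by rewrite -scalemxAr uX0 ?scaler0 // mem_nth.
Qed.

(** The annihilator is the kernel of right multiplication by a matrix [M] whose columns form a basis
    of [U]. Full column rank makes this map onto, and rank-nullity gives the dimension. *)
Lemma card_annihilator (U : {vspace 'cV[F]_k}) :
  #|[set u : 'rV[F]_k | [forall (x | x \in U), u *m x == 0]]|
  = (#|F| ^ (k - \dim U))%N.
Proof.
pose M : 'M[F]_(k, \dim U) := \matrix_(i, j) (vbasis U)`_j i 0.
have colM j : col j M = (vbasis U)`_j.
  by apply/matrixP => i l; rewrite !mxE !ord1.
have Mfull : row_full M.
  rewrite /row_full -mxrank_tr; apply: inj_row_free => v vM0.
  have /freeP freeU := basis_free (vbasisP U).
  apply/rowP => j; rewrite mxE; apply: (freeU (fun j => v 0 j)).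
  apply/trmx_inj; rewrite trmx0 -vM0 mulmx_sum_row linear_sum.
  apply: eq_bigr => i _; rewrite linearZ /= -colM.
  by rewrite tr_col.
pose phi := linfun (mulmxr M : 'rV[F]_k -> 'rV_(\dim U)).
have phiE u : phi u = u *m M by rewrite lfunE.
have limg_phi : limg phi = fullv.
  apply/vspaceP => w; rewrite memvf; apply/memv_imgP.
  have [B BM1] := row_fullP Mfull.
  by exists (w *m B); rewrite ?memvf // phiE -mulmxA BM1 mulmx1.
have dim_ker : \dim (lker phi) = (k - \dim U)%N.
  have := limg_ker_dim phi fullv.
  rewrite limg_phi capfv !dimvf /dim /= !mul1n.
  by move/(canRL (addnK _)).
rewrite -dim_ker -card_vspace; apply: eq_card => u.
rewrite inE memv_ker phiE; apply/forall_inP/eqP => [uU0|uM0 x xU].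
  apply/rowP => j; rewrite mxE.
  have ltj : (j < size (vbasis U))%N by rewrite size_tuple.
  have /eqP/matrixP/(_ 0 0) := uU0 _ (vbasis_mem (mem_nth 0 ltj)).
  rewrite !mxE => {2}<-; apply: eq_bigr => i _.
  by rewrite !mxE.
apply/eqP; move: x xU; rewrite -(span_basis (vbasisP U)).
apply: vanish_span => x /(nthP 0)[j]; rewrite size_tuple => ltj <-.
by rewrite -(colM (Ordinal ltj)) colE mulmxA uM0 mul0mx.
Qed.

(** Entry j of [u *m G] is u times column j, so vanishing on [A] means annihilating the span of the
    columns in [A]. *)
Lemma card_messages_vanishing (A : {set 'I_n}) :
  #|[set u : 'rV[F]_k | [forall j in A, (u *m G) 0 j == 0]]|
  = (#|F| ^ (k - col_rank G A))%N.
Proof.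
rewrite -card_annihilator; apply: eq_card => u; rewrite !inE.
have entryE j : ((u *m G) 0 j == 0) = (u *m col j G == 0).
  rewrite colE mulmxA -colE; apply/eqP/eqP => [uj0|/matrixP/(_ 0 0)].
    by apply/matrixP => i l; rewrite !ord1 !mxE -[RHS]uj0 mxE.
  by rewrite !mxE.
apply/forall_inP/forall_inP => [uA0 x xA|uU0 j jA].
  apply/eqP; apply: vanish_span xA => y /mapP[j].
  by rewrite mem_enum => jA ->; apply/eqP; rewrite -entryE uA0.
rewrite entryE uU0 // memv_span //; apply: map_f; by rewrite mem_enum.
Qed.

Variable C : {vspace 'rV[F]_n}.
Hypothesis genG : generator_matrix C G.

Let rows : k.-tuple 'rV[F]_n := [tuple of map (fun i => row i G) (ord_tuple k)].

Let rowsE (i : 'I_k) : rows`_i = row i G.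
Proof. by rewrite -tnth_nth tnth_map tnth_ord_tuple. Qed.

Let rows_basis : basis_of C rows.
Proof. exact: genG. Qed.

Lemma encode_inj : injective (fun u : 'rV[F]_k => u *m G).
Proof.
move=> u v /= /eqP; rewrite -subr_eq0 -mulmxBl => /eqP uvG0.
apply/eqP; rewrite -subr_eq0; apply/eqP/rowP => i; rewrite [RHS]mxE.
have /freeP freeX := basis_free rows_basis.
apply: (freeX (fun i => (u - v) 0 i)); rewrite -[RHS]uvG0 mulmx_sum_row.
by apply: eq_bigr => j _; rewrite rowsE.
Qed.

Lemma mem_code v : (v \in C) = (v \in [set u *m G | u : 'rV[F]_k]).
Proof.
apply/idP/imsetP => [vC|[u _ ->]].
  move: vC; rewrite -(span_basis rows_basis) => /coord_span vE.
  exists (\row_i coord rows i v) => //; rewrite {1}vE mulmx_sum_row.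
  by apply: eq_bigr => i _; rewrite rowsE mxE.
rewrite mulmx_sum_row memv_suml // => i _; rewrite memvZ // -rowsE.
by rewrite (basis_mem rows_basis) // mem_nth // size_tuple.
Qed.

Lemma card_codewords_vanishing (A : {set 'I_n}) :
  #|[set v : 'rV[F]_n | (v \in C) && [forall j in A, v 0 j == 0]]|
  = (#|F| ^ (k - col_rank G A))%N.
Proof.
rewrite -card_messages_vanishing -(card_imset _ encode_inj).
apply: eq_card => v; rewrite inE mem_code.
apply/andP/imsetP => [[/imsetP[u _ ->] uA0]|[u]].
  by exists u; rewrite ?inE.
by rewrite inE => uA0 ->; split=> //; apply/imsetP; exists u.
Qed.

(** By injectivity of encoding only the zero message vanishes everywhere, so q^(k - r(G)) = 1, and q
    > 1 forces r(G) = k. *)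
Lemma col_rank_generator : col_rank G [set: 'I_n] = k.
Proof.
apply/eqP; rewrite eqn_leq col_rank_le_height -subn_eq0.
have := card_messages_vanishing [set: 'I_n].
rewrite (_ : [set u | _] = [set 0]) => [|].
  rewrite cards1; case: (k - _)%N => // m; have := card_finNzRing_gt1 F.
  rewrite expnS => q_gt1 /esym/eqP; rewrite muln_eq1 => /andP[/eqP q1].
  by rewrite q1 in q_gt1.
apply/setP => u; rewrite !inE; apply/forall_inP/eqP => [u0|-> j _].
  apply: encode_inj; rewrite /= mul0mx; apply/rowP => j.
  by rewrite (eqP (u0 j (in_setT j))) mxE.
by rewrite mul0mx mxE.
Qed.

End Code.

Lemma hweight_le (F : finFieldType) n (v : 'rV[F]_n) : (hweight v <= n)%N.
Proof. by rewrite -[leqRHS]card_ord max_card. Qed.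

Lemma sum_by_weight (F : finFieldType) (n : nat) (C : {vspace 'rV[F]_n})
    (V : pzSemiRingType) (h : nat -> V) :
  \sum_(v in C) h (hweight v) = \sum_(w < n.+1) (weight_count C w)%:R * h w.
Proof.
pose wt (v : 'rV[F]_n) : 'I_n.+1 := inord (hweight v).
have wtE v : wt v = hweight v :> nat by rewrite inordK // ltnS hweight_le.
rewrite (partition_big wt predT) //=; apply: eq_bigr => w _.
rewrite (eq_bigr (fun=> h w)) => [|v /andP[_ /eqP <-]]; last by rewrite wtE.
rewrite sumr_const mulr_natl; congr (_ *+ _); apply: eq_card => v.
by rewrite !inE -wtE.
Qed.

(** * Evaluation of the weight and rank polynomials *)

Section Evaluation.
Variables (K : fieldType) (f : {rmorphism rat -> K}).
Implicit Types x y : K.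

(** A ring morphism from the rationals must agree with [ratr]; replacing [ratr] by [f] makes
    evaluation a ring morphism. *)
Lemma eval2E (p : {mpoly rat[2]}) x y :
  eval2 p x y = mmap f (fun i : 'I_2 => if i == ord0 then x else y) p.
Proof.
by apply: eq_bigr => m _; rewrite fmorph_eq_rat.
Qed.

Lemma eval2_sum (I : Type) (r : seq I) (P : pred I)
    (p : I -> {mpoly rat[2]}) x y :
  eval2 (\sum_(i <- r | P i) p i) x y = \sum_(i <- r | P i) eval2 (p i) x y.
Proof.
by rewrite eval2E rmorph_sum; apply: eq_bigr => i _; rewrite eval2E.
Qed.

Lemma eval2Z c (p : {mpoly rat[2]}) x y :
  eval2 (c *: p) x y = f c * eval2 p x y.
Proof. by rewrite !eval2E mmapZ. Qed.

Lemma eval2_monomial a b x y :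
  eval2 (bivar_x ^+ a * bivar_y ^+ b) x y = x ^+ a * y ^+ b.
Proof. by rewrite eval2E rmorphM !rmorphXn /= !mmapX !mmap1U. Qed.

Lemma eval2_weight_enum (F : finFieldType) n (C : {vspace 'rV[F]_n}) x y :
  eval2 (norm_weight_enum C) x y =
  \sum_(w < n.+1) f ('C(n, w)%:R^-1 * (weight_count C w)%:R)
    * (x ^+ (n - w) * y ^+ w).
Proof.
by rewrite eval2_sum; apply: eq_bigr => w _; rewrite eval2Z eval2_monomial.
Qed.

(** The exponents of [t] add up to n - a and those of [z] to a, so the rank r survives only in the
    power of q. *)
Lemma homogenize_rank_term (q t z : K) (n k r a : nat) :
  t != 0 -> z != 0 -> (r <= k <= n)%N -> (r <= a <= n)%N ->
  (q * t / z) ^+ (k - r) * (z / t) ^+ (a - r) * z ^+ k * t ^+ (n - k) =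
  q ^+ (k - r) * (t ^+ (n - a) * z ^+ a).
Proof.
move=> t0 z0 /andP[lerk lekn] /andP[lera lean].
have -> : z ^+ k = z ^+ (k - r) * z ^+ r by rewrite -exprD subnK.
have -> : z ^+ a = z ^+ (a - r) * z ^+ r by rewrite -exprD subnK.
have [e ea] : exists e, (a - r = e)%N by exists (a - r)%N.
have [e' ek] : exists e, (k - r = e)%N by exists (k - r)%N.
rewrite ea ek !exprMn !exprVn.
have -> : t ^+ (n - k) = t ^+ (n - a) * t ^+ e / t ^+ e'.
  apply: (mulIf (expf_neq0 e' t0)); rewrite divfK ?expf_neq0 // -!exprD.
  by congr (_ ^+ _); lia.
by field; rewrite !expf_neq0.
Qed.

(* The truncated subtractions implement Y ^ (m - k) for m = n - b, where for
   m < k the negative power is traded for (X / q) ^ (k - m) since X Y = q. *)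
Definition complementary_rank_gen (a : nat -> rat) (q n k : nat) :
    {mpoly rat[2]} :=
  \sum_(w < n.+1) a w *: \sum_(b < n.+1)
    ('C(b, n - w)%:R * q%:R^-1 ^+ (k - (n - b))) *:
      (bivar_x ^+ (k - (n - b)) * bivar_y ^+ (n - b - k)).

Lemma eval2_complementary_rank_gen (a : nat -> rat) (q n k : nat) (s z : K) :
  s != 0 -> z != 0 -> (0 < q)%N -> (k <= n)%N ->
  eval2 (complementary_rank_gen a q n k) (q%:R * s / z) (z / s)
    * z ^+ k * s ^+ (n - k) =
  \sum_(w < n.+1) f (a w) * negbin_sum n (n - w) s z.
Proof.
move=> s0 z0 q_gt0 lekn; rewrite eval2_sum !mulr_suml; apply: eq_bigr => w _.
rewrite eval2Z -!mulrA; congr (_ * _); rewrite eval2_sum mulr_suml.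
apply: eq_bigr => b _; rewrite eval2Z eval2_monomial.
have ltbn : (b < n.+1)%N by [].
set m := (n - b)%N; have lemn : (m <= n)%N by rewrite leq_subr.
have q0 : q%:R != 0 :> K.
  by rewrite -(rmorph_nat f) fmorph_eq0 Num.Theory.pnatr_eq0 -lt0n.
(* A fictitious rank [minn k m] for a set of size [m] has exactly the truncated exponents k - m and
   m - k; the resulting q^(k - m) cancels the coefficient. *)
have min1 : (minn k m <= k <= n)%N by rewrite geq_minl.
have min2 : (minn k m <= m <= n)%N by rewrite geq_minr.
have := homogenize_rank_term q%:R s0 z0 min1 min2.
have -> : (k - minn k m = k - m)%N by lia.
have -> : (m - minn k m = m - k)%N by lia.
have -> : (n - m = b)%N by lia.
rewrite -!mulrA => ->; rewrite rmorphM rmorphXn fmorphV !rmorph_nat.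
by rewrite -mulrA [_^-1 ^+ _ * _]mulrA -exprMn mulVf // expr1n mul1r.
Qed.

Variables (F : finFieldType) (n k : nat).
Variables (C : {vspace 'rV[F]_n}) (G : 'M[F]_(k, n)).
Hypothesis genG : generator_matrix C G.
Hypothesis lekn : (k <= n)%N.

(* q ^ (k - r(A)) counts the codewords vanishing on A, so
   exchanging the sums over A and over codewords groups the terms by weight. *)
Lemma eval2_rank_gen (t z : K) : t != 0 -> z != 0 ->
  eval2 (norm_rank_gen G) (#|F|%:R * t / z) (z / t) * z ^+ k * t ^+ (n - k) =
  \sum_(w < n.+1) f ('C(n, w)%:R^-1 * (weight_count C w)%:R)
    * negbin_sum n w t z.
Proof.
move=> t0 z0.
pose inord_card (A : {set 'I_n}) : 'I_n.+1 := inord #|A|.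
have inord_cardE A : inord_card A = #|A| :> nat.
  by rewrite inordK // ltnS -[leqRHS]card_ord max_card.
pose g a := f 'C(n, a)%:R^-1 * (t ^+ (n - a) * z ^+ a).
transitivity (\sum_(A : {set 'I_n}) #|F|%:R ^+ (k - col_rank G A) * g #|A|).
  rewrite (partition_big inord_card predT) //= eval2_sum !mulr_suml.
  apply: eq_bigr => a _; rewrite eval2Z eval2_sum mulr_sumr !mulr_suml.
  apply: eq_big => [A|A /eqP cardA]; first by rewrite -val_eqE /= inord_cardE.
  rewrite eval2_monomial (col_rank_generator genG) /g cardA [RHS]mulrCA.
  rewrite -(homogenize_rank_term _ t0 z0 _ (_ : col_rank G A <= a <= n)%N).
  - by rewrite !mulrA.
  - by rewrite col_rank_le_height.
  - by rewrite -{1}cardA col_rank_le_card -ltnS ltn_ord.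
transitivity (\sum_(A : {set 'I_n})
    \sum_(v in C | [forall j in A, v 0 j == 0]) g #|A|).
  apply: eq_bigr => A _; rewrite sumr_const -[RHS]mulr_natl; congr (_ * _).
  rewrite -natrX -(card_codewords_vanishing genG A); congr (_%:R).
  by apply: eq_card => v; rewrite inE.
rewrite (exchange_big_dep (fun v => v \in C)) /=; last by move=> A v _ /andP[].
(* A codeword of weight w vanishes on exactly the subsets of its n - w zero positions. *)
pose h w := \sum_(a < n.+1) 'C(n - w, a)%:R * g a.
transitivity (\sum_(v in C) h (hweight v)).
  apply: eq_bigr => v vC.
  rewrite (partition_big inord_card predT) //=.
  apply: eq_bigr => a _.
  have := card_sets_avoiding [set j | v 0 j != 0] a.
  rewrite card_ord -/(hweight v) => <-; rewrite mulr_natl -sumr_const.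
  have cardK A : (inord_card A == a) = (#|A| == a).
    by rewrite -val_eqE /= inord_cardE.
  apply: eq_big => [A|A /andP[_]]; last by rewrite cardK => /eqP ->.
  rewrite inE vC cardK /=; congr (_ && _); apply: eq_forallb => j.
  by rewrite inE negbK.
rewrite sum_by_weight; apply: eq_bigr => w _.
rewrite rmorphM rmorph_nat mulrAC [RHS]mulrC; congr (_ * _).
(* Setting a = n - b, the claim reduces termwise to C(n-w, n-b) / C(n, n-b) = C(b, w) / C(n, w),
   which is [mul_bin_swap]. *)
rewrite /h /negbin_sum (reindex_inj rev_ord_inj) /= mulr_sumr.
apply: eq_bigr => b _; rewrite subSS /g subKn -1?ltnS //.
have binf0 a : (a <= n)%N -> f 'C(n, a)%:R != 0.
  by move=> lea; rewrite fmorph_eq0 Num.Theory.pnatr_eq0 -lt0n bin_gt0.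
have lewn : (w <= n)%N by rewrite -ltnS.
have leb : (n - b <= n)%N by rewrite leq_subr.
have := congr1 (fun m : nat => f m%:R) (mul_bin_swap lewn leb).
rewrite subKn -1?ltnS // !natrM !rmorphM !fmorphV => swap.
apply: (mulIf (binf0 _ lewn)); apply: (mulIf (binf0 _ leb)).
rewrite !rmorph_nat in swap *.
have bw := binf0 _ lewn; have bb := binf0 _ leb; rewrite !rmorph_nat in bw bb.
transitivity ('C(n - w, n - b)%:R * 'C(n, w)%:R * (t ^+ b * z ^+ (n - b))).
  by field.
by rewrite swap; field.
Qed.

End Evaluation.

(** * Recombination into the identity and the congruence *)

Lemma weighted_negbin_split (R : idomainType) (n : nat) (a : nat -> R)
    (s t : R) :
  s != 0 ->
  (\sum_(w < n.+1) a w * (s ^+ (n - w) * t ^+ w)) * (s + t) ^+ n.+1 =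
  (\sum_(w < n.+1) a w * negbin_sum n w t (s + t)) * s ^+ n.+1
  + (\sum_(w < n.+1) a w * negbin_sum n (n - w) s (s + t)) * t ^+ n.+1.
Proof.
move=> s0; rewrite !mulr_suml -big_split; apply: eq_bigr => w _ /=.
by rewrite -mulrA negbin_split -1?ltnS //; ring.
Qed.

Theorem mainTheorem3 (F : finFieldType) (n k : nat) (C : {vspace 'rV[F]_n})
    (G : 'M[F]_(k, n)) (dimC : \dim C = k) (genG : generator_matrix C G) :
  (exists Wt : {mpoly rat[2]},
     let s : {fraction {mpoly rat[2]}} := bivar_x%:F in
     let t : {fraction {mpoly rat[2]}} := bivar_y%:F in
     let q : {fraction {mpoly rat[2]}} := #|F|%:R in
     let term1 := eval2 (norm_rank_gen G) (q * t / (s + t)) ((s + t) / t)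
                  * (s + t) ^+ k * t ^+ (n - k) * s ^+ n.+1 in
     let term2 := eval2 Wt (q * s / (s + t)) ((s + t) / s)
                  * (s + t) ^+ k * s ^+ (n - k) * t ^+ n.+1 in
     [/\ is_polynomial term1, is_polynomial term2
       & eval2 (norm_weight_enum C) s t * (s + t) ^+ n.+1 = term1 + term2])
  /\
  (let t : {fraction {poly rat}} := ('X)%:F in
   let q : {fraction {poly rat}} := #|F|%:R in
   poly_congr n.+1
     (eval2 (norm_weight_enum C) 1 t * (1 + t) ^+ n.+1)
     (eval2 (norm_rank_gen G) (q * t / (1 + t)) ((1 + t) / t)
      * (1 + t) ^+ k * t ^+ (n - k))).
Proof.
have lekn : (k <= n)%N.
  by rewrite -dimC (leq_trans (dimvS (subvf _))) // dimvf /dim /= mul1n.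
pose a (w : nat) : rat := 'C(n, w)%:R^-1 * (weight_count C w)%:R.
split.
  have q_gt0 : (0 < #|F|)%N by apply/card_gt0P; exists 0.
  pose g : {rmorphism rat -> {mpoly rat[2]}} := @mpolyC 2 rat.
  pose f : {rmorphism rat -> {fraction {mpoly rat[2]}}} := @tofrac _ \o g.
  exists (complementary_rank_gen a #|F| n k) => s t q.
  (* Evaluating at (1, 1) shows that the denominators s, t and s + t are nonzero. *)
  have neq0 (p : {mpoly rat[2]}) : p.@[fun=> 1] != 0 -> p%:F != 0.
    by apply: contraNneq => /eqP; rewrite tofrac_eq0 => /eqP ->; rewrite meval0.
  have s0 : s != 0 by apply: neq0; rewrite mevalXU.
  have t0 : t != 0 by apply: neq0; rewrite mevalXU.
  have stE : s + t = (bivar_x + bivar_y)%:F by rewrite rmorphD.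
  have z0 : s + t != 0 by rewrite stE; apply: neq0; rewrite mevalD !mevalXU.
  rewrite (eval2_rank_gen f genG lekn t0 z0).
  rewrite (eval2_complementary_rank_gen f a s0 z0 q_gt0 lekn).
  rewrite (eval2_weight_enum f); split.
  (* Both terms are now combinations of [negbin_sum], which involves no division, so the same
     expressions over the polynomial ring are witnesses. *)
  - exists ((\sum_(w < n.+1) g (a w)
               * negbin_sum n w bivar_y (bivar_x + bivar_y)) * bivar_x ^+ n.+1).
    rewrite rmorphM rmorphXn rmorph_sum stE; congr (_ * _).
    by apply: eq_bigr => w _; rewrite [RHS]rmorphM rmorph_negbin_sum.
  - exists ((\sum_(w < n.+1) g (a w)
               * negbin_sum n (n - w) bivar_x (bivar_x + bivar_y))
            * bivar_y ^+ n.+1).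
    rewrite rmorphM rmorphXn rmorph_sum stE; congr (_ * _).
    by apply: eq_bigr => w _; rewrite [RHS]rmorphM rmorph_negbin_sum.
  - exact: (weighted_negbin_split n (fun w => f (a w)) t s0).
move=> t q.
pose g : {rmorphism rat -> {poly rat}} := @polyC rat.
pose f : {rmorphism rat -> {fraction {poly rat}}} := @tofrac _ \o g.
have t0 : t != 0 by rewrite tofrac_eq0 polyX_eq0.
have zE : 1 + t = (1 + 'X)%:F by rewrite rmorphD rmorph1.
have z0 : 1 + t != 0.
  by rewrite zE tofrac_eq0 addrC -[1]opprK -polyC1 -polyCN polyXsubC_eq0.
rewrite (eval2_rank_gen f genG lekn t0 z0) (eval2_weight_enum f).
exists ((\sum_(w < n.+1) g (a w) * (1 ^+ (n - w) * 'X ^+ w))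
        * (1 + 'X) ^+ n.+1).
exists (\sum_(w < n.+1) g (a w) * negbin_sum n w 'X (1 + 'X)).
split.
- rewrite rmorphM rmorphXn rmorph_sum zE; congr (_ * _).
  by apply: eq_bigr => w _; rewrite !rmorphM !rmorphXn rmorph1.
- rewrite rmorph_sum zE; apply: eq_bigr => w _.
  by rewrite [RHS]rmorphM rmorph_negbin_sum.
(* At s = 1 the difference is the complementary sum times ['X ^+ n.+1]. *)
- rewrite (weighted_negbin_split n (fun w => g (a w))) ?oner_eq0 //.
  by rewrite expr1n mulr1 addrC addKr dvdp_mull.
Qed.
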